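(* Let $\theta=(N-k,1,\ldots,1)\vdash N$ be a hook partition and $\mu/\nu$ a skew shape with no empty rows, with $|\mu/\nu|=N$ and associated Hessenberg function $h:[n]\to[n]$. For $J\subset[n-1]$ let $$h^J(i)=\begin{cases}h(i)-1 & \text{if } i\in J \text{ and } \mu_{h(i)}-\nu_i+i-h(i)=0,\\ h(i)&\text{otherwise.}\end{cases}$$ Then $$\Gamma^\theta_{\mu/\nu}=\sum_{\substack{J\subset[n-1]\\|J|=k}}\Gamma_{h^J}.$$ Furthermore, if terms are collected so that $\Gamma^\theta_{\mu/\nu}=\sum_J c_J\Gamma_{h^J}$, where $J$ ranges over a set of $k$-element subsets of $[n-1]$ containing exactly one representative for each distinct Hessenberg function occurring among the $h^J$ (and $c_J$ is the number of $k$-element subsets $J'\subset[n-1]$ with $h^{J'}=h^J$), then $$c_J=\binom{a}{b},\quad a=\bigl|\{i\in[n-1]:\mu_{h(i)}-\nu_i+i-h(i)>0\}\bigr|,\quad b=k-\bigl|\{i\in[n-1]:h(i)\ne h^J(i)\}\bigr|.$$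
   Context: Partitions are weakly decreasing sequences of positive integers, extended by zeros when needed ($\nu$ may be empty). A skew shape $\mu/\nu$ is a pair of partitions with $\nu_i\le\mu_i$ for all $i$; its length $\ell(\mu/\nu)$ is the largest $i$ with $\nu_i<\mu_i$, and $|\mu/\nu|=\sum_i(\mu_i-\nu_i)$. Here $n=\ell(\mu/\nu)$, and ''no empty rows'' means $\nu_i<\mu_i$ for all $i\in[n]=\{1,\ldots,n\}$. The hook partition $\theta=(N-k,1,\ldots,1)$ has $k$ ones after the first part, $0\le k\le N-1$. For $\theta\vdash N$ and an integer sequence $c=(c_1,\ldots,c_n)$ summing to $N$, $K_{\theta,c}$ is the number of semistandard Young tableaux of shape $\theta$ with content $c$; it is $0$ if some $c_i<0$. Let $\delta=(n-1,\ldots,1,0)$, regard $\mu,\nu$ as their first $n$ entries, and let $w\in S_n$ act by $w(a_1,\ldots,a_n)=(a_{w^{-1}(1)},\ldots,a_{w^{-1}(n)})$. The immanant character $\Gamma^\theta_{\mu/\nu}:S_n\to\mathbb{Z}$ is $$\Gamma^\theta_{\mu/\nu}(w)=\frac{n!}{|C(w)|}\sum_{w'\in C(w)}K_{\theta,\ \mu+\delta-w'(\nu+\delta)},$$ where $C(w)$ is the conjugacy class of $w$. A Hessenberg function is a weakly increasing $g:[n]\to[n]$ with $g(i)\ge i$ for all $i$. The Hessenberg function associated to $\mu/\nu$ is $h(j)=\max\{i\in[n]:\mu_i-\nu_j+j-i\ge0\}$. For a Hessenberg function $g$, $\widehat g(w)=1$ if $w(i)\le g(i)$ for all $i\in[n]$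 and $\widehat g(w)=0$ otherwise, and $\Gamma_g(w)=\frac{n!}{|C(w)|}\sum_{w'\in C(w)}\widehat g(w')$. Each $h^J$ is a Hessenberg function. *)

(* Defs.v *)
From mathcomp Require Import all_boot all_order all_algebra all_fingroup.
From mathcomp Require Import zify.

Set Implicit Arguments.
Unset Strict Implicit.
Unset Printing Implicit Defensive.

Import GRing.Theory Num.Theory.

Local Open Scope nat_scope.

(* Conventions: rows, columns and elements of [n] are numbered from 0, so     *)
(* that [n] is 'I_n and [n-1] is the set of i : 'I_n with i.+1 < n.           *)
(* Differences of indices, hence all the quantities mu_i - nu_j + j - i, are  *)
(* unaffected by this shift.                                                  *)

Definition is_partition (s : seq nat) : bool := sorted geq s && (0 \notin s).

(* The part of index i, with s extended by zeros. *)
Definition part (s : seq nat) (i : nat) : nat := nth 0 s i.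

Definition is_skew_shape (mu nu : seq nat) : Prop :=
  [/\ is_partition mu, is_partition nu & forall i, part nu i <= part mu i].

(* The successor converts the 0-based row i to its 1-based number; the value  *)
(* is 0 when mu = nu.                                                         *)
Definition skew_length (mu nu : seq nat) : nat :=
  \max_(i < size mu | part nu i < part mu i) i.+1.

Definition skew_size (mu nu : seq nat) : nat :=
  \sum_(i < size mu) (part mu i - part nu i).

Definition no_empty_rows (mu nu : seq nat) : Prop :=
  forall i, i < skew_length mu nu -> part nu i < part mu i.

Definition hook (N k : nat) : seq nat := (N - k) :: nseq k 1.

Lemma hook_partition (N k : nat) :
  k < N -> is_partition (hook N k) /\ sumn (hook N k) = N.
Proof.
move=> kN; split; last by rewrite /= sumn_nseq mul1n; lia.
rewrite /is_partition /hook inE mem_nseq /= andbF orbF; apply/andP; split.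
  by case: k kN => //= k kN; rewrite subn_gt0 kN /=; elim: k {kN}.
by rewrite eq_sym subn_eq0 -ltnNge.
Qed.

Section Tableaux.

Variable th : seq nat.

(* A cell is a row i together with a column j < th_i. *)
Definition cell : finType := {i : 'I_(size th) & 'I_(part th i)}.

Definition cell_row (p : cell) : nat := tag p.
Definition cell_col (p : cell) : nat := tagged p.

Variable n : nat.

Definition semistandard (T : {ffun cell -> 'I_n}) : bool :=
  [forall p, forall q,
     ((cell_row p == cell_row q) && (cell_col p <= cell_col q)
        ==> (T p <= T q)) &&
     ((cell_row p < cell_row q) && (cell_col p == cell_col q)
        ==> (T p < T q))].

Definition has_content (T : {ffun cell -> 'I_n}) (c : 'I_n -> int) : bool :=
  [forall i, #|[set p | T p == i]|%:Z == c i]%R.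

Definition kostka (c : 'I_n -> int) : nat :=
  #|[set T : {ffun cell -> 'I_n} | semistandard T && has_content T c]|.

End Tableaux.

Definition delta (n : nat) (i : 'I_n) : nat := n - i.+1.

Definition perm_act (n : nat) (A : Type) (w : 'S_n) (a : 'I_n -> A) : 'I_n -> A :=
  fun i => a ((w^-1)%g i).

(* mu + delta - w (nu + delta) *)
Definition immanant_content (n : nat) (mu nu : seq nat) (w : 'S_n) (i : 'I_n)
    : int :=
  ((part mu i + delta i)%:Z
     - (perm_act w (fun j : 'I_n => part nu j + delta j) i)%:Z)%R.

Definition conj_class (n : nat) (w : 'S_n) : {set 'S_n} :=
  (w ^: [set: 'S_n])%g.

Lemma card_conj_class_dvdn (n : nat) (w : 'S_n) : #|conj_class w| %| n`!.
Proof.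
have -> : n`! = #|[set: 'S_n]| by rewrite cardsT card_Sn.
by rewrite -index_cent1 dvdn_indexg.
Qed.

(* The division is exact by card_conj_class_dvdn.                             *)
Definition class_sum (n : nat) (f : 'S_n -> nat) (w : 'S_n) : int :=
  ((n`! %/ #|conj_class w|) * \sum_(w' in conj_class w) f w')%N%:Z.

Definition immanant_char (n : nat) (th mu nu : seq nat) : 'S_n -> int :=
  class_sum (fun w => kostka th (immanant_content mu nu w)).

Definition is_hessenberg (n : nat) (g : {ffun 'I_n -> 'I_n}) : Prop :=
  (forall i j : 'I_n, i <= j -> g i <= g j) /\ (forall i : 'I_n, i <= g i).

Definition hess_ind (n : nat) (g : {ffun 'I_n -> 'I_n}) (w : 'S_n) : nat :=
  [forall i, w i <= g i].

Definition hess_char (n : nat) (g : {ffun 'I_n -> 'I_n}) : 'S_n -> int :=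
  class_sum (hess_ind g).

Section AssociatedHessenberg.

Variables (n : nat) (mu nu : seq nat).

Definition jt_entry (i j : nat) : int :=
  ((part mu i)%:Z - (part nu j)%:Z + j%:Z - i%:Z)%R.

(* The default j belongs to the set, since nu_j <= mu_j for a skew shape. *)
Definition hess : {ffun 'I_n -> 'I_n} :=
  [ffun j : 'I_n => [arg max_(i > j | (0 <= jt_entry i j)%R) (i : nat)]].

(* Truncated at 0; this is harmless in hessJ, where the predecessor is only   *)
(* taken when jt_entry (hess i) i = 0, which forces i < hess i when           *)
(* nu_i < mu_i.                                                               *)
Definition opred (i : 'I_n) : 'I_n :=
  Ordinal (leq_ltn_trans (leq_pred i) (ltn_ord i)).

Definition hessJ (J : {set 'I_n}) : {ffun 'I_n -> 'I_n} :=
  [ffun i => if (i \in J) && (jt_entry (hess i) i == 0%R)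
             then opred (hess i) else hess i].

Definition init_seg : {set 'I_n} := [set i : 'I_n | i.+1 < n].

Definition ksubsets (k : nat) : {set {set 'I_n}} :=
  [set J : {set 'I_n} | (J \subset init_seg) && (#|J| == k)].

Definition is_hessJ_representatives (k : nat) (R : {set {set 'I_n}}) : Prop :=
  R \subset ksubsets k /\
  forall J', J' \in ksubsets k ->
    exists! J, J \in R /\ hessJ J = hessJ J'.

Definition hessJ_mult (k : nat) (J : {set 'I_n}) : nat :=
  #|[set J' in ksubsets k | hessJ J' == hessJ J]|.

Definition free_count : nat :=
  #|[set i in init_seg | (0 < jt_entry (hess i) i)%R]|.

(* The set of i with hess i != hessJ J i is contained in J, so that           *)
(* k - lowered_count J does not truncate when #|J| = k.                       *)
Definition lowered_count (J : {set 'I_n}) : nat :=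
  #|[set i in init_seg | hess i != hessJ J i]|.

End AssociatedHessenberg.

Lemma part_le (s : seq nat) (i j : nat) :
  is_partition s -> i <= j -> part s j <= part s i.
Proof.
case/andP=> ss _ ij; rewrite /part.
have [js|js] := ltnP j (size s); last by rewrite nth_default.
have tr : transitive geq by move=> y x z /= xy yz; exact: leq_trans yz xy.
exact: (sorted_leq_nth tr leqnn 0 ss _ _ (leq_ltn_trans ij js) js ij).
Qed.

Lemma hessJ_is_hessenberg (n : nat) (mu nu : seq nat) (J : {set 'I_n}) :
  is_skew_shape mu nu -> skew_length mu nu = n -> no_empty_rows mu nu ->
  is_hessenberg (hessJ mu nu J).
Proof.
move=> [pmu pnu le_nu] len ner.
have hP (j : 'I_n) : [/\ (0 <= jt_entry mu nu (hess n mu nu j) j)%R, j <= hess n mu nu j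
   & forall i : 'I_n, (0 <= jt_entry mu nu i j)%R -> i <= hess n mu nu j].
  rewrite ffunE; case: arg_maxnP => [|i Pi max].
    by rewrite /jt_entry; have := le_nu j; lia.
  by split=> //; apply: max; rewrite /jt_entry; have := le_nu j; lia.
have lt_nu (i : 'I_n) : part nu i < part mu i by apply: ner; rewrite len.
split=> [i j ij|i]; rewrite ![hessJ _ _ _ _]ffunE.
  have [ei _ mi] := hP i; have [ej lj mj] := hP j.
  have pij := part_le pnu ij.
  have hij : hess n mu nu i <= hess n mu nu j.
    by apply: mj; move: ei; rewrite /jt_entry; lia.
  case: ifP => [_|nti]; case: ifP => [/andP[Jj /eqP tj]|_] //=; try lia.
  have ltij : i < j.
    rewrite ltn_neqAle ij andbT; apply/negP => /eqP/val_inj eij.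
    by move: nti; rewrite eij Jj tj eqxx.
  suff : (hess n mu nu i : nat) <> hess n mu nu j by lia.
  by move=> e; move: tj ei; rewrite /jt_entry e; lia.
have [ei li _] := hP i.
case: ifP => [/andP[_ /eqP ti]|_] //=.
suff : (hess n mu nu i : nat) <> i by lia.
by move=> e; move: ti; rewrite /jt_entry e; have := lt_nu i; lia.
Qed.

(* Main.v *)
Require Import Defs.
From mathcomp Require Import all_boot all_order all_algebra all_fingroup.
From mathcomp Require Import zify.

Set Implicit Arguments.
Unset Strict Implicit.
Unset Printing Implicit Defensive.

Import Order.TTheory GRing.Theory Num.Theory.

Local Open Scope nat_scope.

(** Both identities already hold before averaging over conjugacy classes: for
    every permutation w, the Kostka number of the hook at the content
    mu + delta - w (nu + delta) is the number of k-subsets J of [n-1] such that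
    w lies below h^J.  There are two counts to compare.

    On the tableau side, a semistandard tableau of hook shape with content c is
    determined by the set of entries of its leg: the leg is strictly increasing,
    and the arm is the weakly increasing rearrangement of what is left.  The
    corner has to hold the least entry present, so the leg may be any k-subset of
    the other entries present, whence
        K = C(p - 1, k),  p = number of positive entries of c ([kostka_hook]),
    provided that c is nonnegative; otherwise K = 0.

    On the Hessenberg side, entry w j of the content is the Jacobi-Trudi entry
    jt (w j) j = mu_(w j) - nu_j + j - w j ([immanant_content_perm]), where jt i j
    strictly decreases in i because mu is a partition.  Hence w j <= h j means
    jt (w j) j >= 0, and w j <= h^J j means in addition that jt (w j) j is nonzero
    if j is in J ([leq_hessJ]).  So, when the content is nonnegative, w lies below
    h^J exactly when J consists of positions j with jt (w j) j > 0.  The last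
    position always has this property, as no row is empty: mu_(w n) >= mu_n > nu_n
    and w n <= n.  So p - 1 of these positions lie in [n-1], and the two counts
    agree ([kostka_hook_content]).

    For the multiplicities, h^J only depends on the trace of J on the positions
    where jt (h j) j = 0 ([hessJ_eq]); the remaining elements of J are chosen freely
    among the positions of [n-1] where jt (h j) j > 0. *)

(** * Semistandard tableaux of hook shape *)

Lemma cell_inj (th : seq nat) (p q : cell th) :
  cell_row p = cell_row q -> cell_col p = cell_col q -> p = q.
Proof.
case: p q => [i j] [i' j']; rewrite /cell_row /cell_col /= => /val_inj eii.
by case: i' / eii j' => j' /val_inj ->.
Qed.

Section HookTableaux.

Variables N k : nat.

Lemma part_hook_leg i : i < k -> 0 < part (hook N k) i.+1.
Proof. by move=> ik; rewrite /part /= nth_nseq ik. Qed.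

Lemma size_hook : size (hook N k) = k.+1.
Proof. by rewrite /= size_nseq. Qed.

Lemma leg_row_subproof (i : 'I_k) : i.+1 < size (hook N k).
Proof. by rewrite size_hook ltnS. Qed.

(** The corner belongs to the arm. *)
Definition arm_cell (j : 'I_(N - k)) : cell (hook N k) :=
  Tagged (fun i : 'I_(size (hook N k)) => 'I_(part (hook N k) i))
    (j : 'I_(part (hook N k) (@ord0 (size (nseq k 1))))).

Definition leg_cell (i : 'I_k) : cell (hook N k) :=
  Tagged (fun i : 'I_(size (hook N k)) => 'I_(part (hook N k) i))
    (Ordinal (part_hook_leg (ltn_ord i))
      : 'I_(part (hook N k) (Ordinal (leg_row_subproof i)))).

Lemma hook_cellP (p : cell (hook N k)) :
  (exists j, p = arm_cell j) \/ (exists i, p = leg_cell i).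
Proof.
case: p => [[[|i] hi] j]; [left|right].
  by exists j; apply: cell_inj.
have ik : i < k by have := hi; rewrite size_hook.
exists (Ordinal ik); apply: cell_inj => //.
rewrite /cell_col /=; case: j => j /=.
by rewrite /part /= nth_nseq ik ltnS leqn0 => /eqP.
Qed.

Lemma perm_enum_hook_cells :
  perm_eq (enum (cell (hook N k)))
    ([seq arm_cell j | j <- enum 'I_(N - k)] ++ [seq leg_cell i | i <- enum 'I_k]).
Proof.
apply: uniq_perm; first exact: enum_uniq.
  have arm_inj : injective arm_cell by move=> j j' /(congr1 (@cell_col _)) /val_inj.
  have leg_inj : injective leg_cell by move=> i i' /(congr1 (@cell_row _)) [/val_inj].
  rewrite cat_uniq (map_inj_uniq arm_inj) (map_inj_uniq leg_inj) !enum_uniq andbT.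
  by apply/hasPn => _ /mapP[i _ ->]; apply/negP => /mapP[j _ /(congr1 (@cell_row _))].
move=> p; rewrite mem_enum mem_cat.
case: (hook_cellP p) => [[j ->]|[i ->]].
  by rewrite map_f ?mem_enum.
by rewrite orbC map_f ?mem_enum.
Qed.

Variable n : nat.
Implicit Type T : {ffun cell (hook N k) -> 'I_n}.

Definition arm_word T := [seq T (arm_cell j) | j <- enum 'I_(N - k)].
Definition leg_word T := [seq T (leg_cell i) | i <- enum 'I_k].

Lemma card_hook_fiber T x :
  #|[set p | T p == x]| = count_mem x (arm_word T) + count_mem x (leg_word T).
Proof.
rewrite cardsE cardE size_filter -enumT (seq.permP perm_enum_hook_cells) count_cat.
by rewrite !count_map.
Qed.

Lemma hook_words_inj T T' :
  arm_word T = arm_word T' -> leg_word T = leg_word T' -> T = T'.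
Proof.
move=> /eq_in_map eA /eq_in_map eL; apply/ffunP => p.
by case: (hook_cellP p) => [[j ->]|[i ->]]; [apply: eA|apply: eL]; rewrite mem_enum.
Qed.

Let ole : rel 'I_n := fun x y => x <= y.
Let olt : rel 'I_n := fun x y => x < y.

Let ole_trans : transitive ole. Proof. by move=> y x z; apply: leq_trans. Qed.
Let olt_trans : transitive olt. Proof. by move=> y x z; apply: ltn_trans. Qed.
Let ole_refl : reflexive ole. Proof. by move=> x; apply: leqnn. Qed.

Lemma semistandard_hookP T :
  reflect [/\ forall j j' : 'I_(N - k), j <= j' -> T (arm_cell j) <= T (arm_cell j'),
              forall i i' : 'I_k, i < i' -> T (leg_cell i) < T (leg_cell i')
            & forall (i : 'I_k) (j : 'I_(N - k)), j = 0 :> nat ->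
                T (arm_cell j) < T (leg_cell i)]
          (semistandard T).
Proof.
apply: (iffP idP) => [ss|[rT lT cT]].
  have ss2 p q := andP (forallP (forallP ss p) q).
  split=> [j j' jj'|i i' ii'|i j j0].
  - by have [/implyP + _] := ss2 (arm_cell j) (arm_cell j'); apply.
  - by have [_ /implyP] := ss2 (leg_cell i) (leg_cell i'); apply; rewrite /= eqxx andbT.
  - have [_ /implyP] := ss2 (arm_cell j) (leg_cell i); apply.
    by apply/andP; split=> //; apply/eqP.
apply/forallP => p; apply/forallP => q.
case: (hook_cellP p) => [[j ->]|[i ->]]; case: (hook_cellP q) => [[j' ->]|[i' ->]];
  apply/andP; split; apply/implyP; rewrite {1 2}/cell_row {1 2}/cell_col //=.
- exact: rT.
- by move/eqP; apply: cT.
- by rewrite andbT eqSS => /eqP/val_inj ->.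
- by rewrite andbT => /lT.
Qed.

Lemma sorted_arm_word T : semistandard T -> sorted ole (arm_word T).
Proof.
case/semistandard_hookP => rT _ _; rewrite sorted_map.
have := iota_sorted 0 (N - k); rewrite -val_enum_ord sorted_map.
by apply: sub_sorted => j j'; apply: rT.
Qed.

Lemma sorted_leg_word T : semistandard T -> sorted olt (leg_word T).
Proof.
case/semistandard_hookP => _ lT _; rewrite sorted_map.
have := iota_ltn_sorted 0 k; rewrite -val_enum_ord sorted_map.
by apply: sub_sorted => i i'; apply: lT.
Qed.

Variable c : 'I_n -> nat.
Hypothesis lt_kN : k < N.
Hypothesis sum_c : \sum_i c i = N.

Let c' i : int := (c i)%:Z.
Let P : {set 'I_n} := [set i | 0 < c i].
Let tabs := [set T : {ffun cell (hook N k) -> 'I_n} | semistandard T && has_content T c'].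
Let leg_set T := [set x in leg_word T].

Lemma mem_tabsP T : reflect (semistandard T /\
    forall x, count_mem x (arm_word T) + count_mem x (leg_word T) = c x)
  (T \in tabs).
Proof.
rewrite inE; apply: (iffP andP) => -[ss ct]; split=> //.
  by move=> x; rewrite -card_hook_fiber; move/forallP/(_ x)/eqP: ct => [].
by apply/forallP => x; rewrite card_hook_fiber ct.
Qed.

(** The leg is the sorted list of its entries; the arm is then the sorted list of
    the multiset that remains of the content. *)
Lemma leg_set_inj : {in tabs &, injective leg_set}.
Proof.
move=> T T' /mem_tabsP[ssT ctT] /mem_tabsP[ssT' ctT'] eqS.
have eL : leg_word T = leg_word T'.
  apply: (irr_sorted_eq olt_trans) => [x|||x]; rewrite ?sorted_leg_word //.
    exact: ltnn.
  by have := congr1 (fun S : {set _} => x \in S) eqS; rewrite !inE.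
apply: hook_words_inj => //.
apply: (sorted_eq ole_trans) => [x y|||]; rewrite ?sorted_arm_word //.
  by rewrite -eqn_leq => /eqP/val_inj.
apply/allP => x _; apply/eqP; apply: (@addIn (count_mem x (leg_word T))).
by rewrite /= ctT eL ctT'.
Qed.

Variable x0 : 'I_n.
Hypothesis x0P : x0 \in P.
Hypothesis x0_min : forall x, x \in P -> x0 <= x.

(** The leg cannot contain the least entry x0: its entries exceed the corner,
    which is at least x0. *)
Lemma leg_set_draw T : T \in tabs -> (leg_set T \subset P :\ x0) && (#|leg_set T| == k).
Proof.
move=> /mem_tabsP[ssT ctT]; case/semistandard_hookP: (ssT) => rT lT cT.
have uL : uniq (leg_word T).
  rewrite map_inj_uniq ?enum_uniq // => i i' eT; apply: val_inj.
  by case: (ltngtP i i') => // /lT; rewrite eT ltnn.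
have inP x : x \in arm_word T ++ leg_word T -> x \in P.
  by rewrite inE -ctT -count_cat -has_count has_pred1.
apply/andP; split; last first.
  by rewrite cardsE (card_uniqP uL) size_map -cardE card_ord.
apply/subsetP => x; rewrite inE => xL; rewrite in_setD1 inP ?mem_cat ?xL ?orbT // andbT.
have j0 : 0 < N - k by rewrite subn_gt0.
case/mapP: xL => i _ ->; have /= := cT i (Ordinal j0) erefl.
apply: contraTneq => ->; rewrite -leqNgt x0_min // inP // mem_cat.
by apply/orP; left; apply/mapP; exists (Ordinal j0); rewrite ?mem_enum.
Qed.

(** Conversely, put S in the leg in increasing order and the rest of the content
    in the arm in weakly increasing order.  Since x0 is not in S, it is the corner
    entry, and so the first column increases strictly. *)
Lemma leg_set_onto (S : {set 'I_n}) : S \subset P :\ x0 -> #|S| = k ->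
  exists2 T, T \in tabs & leg_set T = S.
Proof.
(* The multiplicities left for the arm once S has been put in the leg. *)
move=> /subsetP SP Sk; pose d x := c x - (x \in S).
have dE x : d x + (x \in S) = c x.
  rewrite subnK //; case: (boolP (x \in S)) => // /SP.
  by rewrite !inE => /andP[].
pose r := sort ole (flatten [seq nseq (d x) x | x <- enum 'I_n]).
have sum_enum (f : 'I_n -> nat) : sumn [seq f x | x <- enum 'I_n] = \sum_x f x.
  by rewrite sumnE big_map big_enum.
have count_r y : count_mem y r = d y.
  rewrite count_sort count_flatten -map_comp sum_enum (bigD1 y) //= big1 => [|x /negPf ne].
    by rewrite count_nseq /= eqxx mul1n addn0.
  by rewrite count_nseq /= ne.
have size_r : size r = N - k.
  rewrite size_sort size_flatten /shape -map_comp sum_enum -sum_c.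
  under eq_bigr do rewrite /= size_nseq.
  under [in RHS]eq_bigr do rewrite -dE.
  by rewrite big_split /= -big_mkcond sum1_card Sk addnK.
have r_sorted : sorted ole r by apply: sort_sorted => x y; exact: leq_total.
have mem_r y : y \in r -> y \in P.
  by rewrite -has_pred1 has_count count_r inE -dE => /ltn_addr ->.
have r0 : nth x0 r 0 = x0.
  have x0r : x0 \in r.
    rewrite -has_pred1 has_count count_r; have := x0P; rewrite inE -dE.
    by case: (boolP (x0 \in S)) => [/SP|_]; rewrite ?addn0 // !inE eqxx.
  have : x0 <= nth x0 r 0 by apply/x0_min/mem_r/mem_nth; case: (r) x0r.
  move=> le; apply: val_inj; apply/eqP; rewrite eqn_leq le andbT.
  have := sorted_leq_nth ole_trans ole_refl x0 r_sorted 0 (index x0 r).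
  by rewrite !inE index_mem x0r nth_index //; apply=> //; case: (r) x0r.
have size_S : size (enum S) = k by rewrite -cardE.
have S_sorted : sorted olt (enum S).
  rewrite [enum S]/enum_mem -enumT; apply: sorted_filter => //.
  by have := iota_ltn_sorted 0 n; rewrite -val_enum_ord sorted_map.
pose T : {ffun cell (hook N k) -> 'I_n} := [ffun p =>
  if cell_row p is i.+1 then nth x0 (enum S) i else nth x0 r (cell_col p)].
have armT : arm_word T = r.
  apply: (@eq_from_nth _ x0); rewrite size_map size_enum_ord ?size_r // => j ltj.
  by rewrite (nth_map (Ordinal ltj)) ?size_enum_ord // ffunE /= {1}/cell_col /= nth_enum_ord.
have legT : leg_word T = enum S.
  apply: (@eq_from_nth _ x0); rewrite size_map size_enum_ord ?size_S // => i lti.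
  by rewrite (nth_map (Ordinal lti)) ?size_enum_ord // ffunE /= nth_enum_ord.
exists T; last by apply/setP => x; rewrite inE legT mem_enum.
apply/mem_tabsP; split; last first.
  move=> x; rewrite armT legT count_r -dE; congr (_ + _).
  by rewrite count_uniq_mem ?enum_uniq // mem_enum.
apply/semistandard_hookP; split=> [j j' jj'|i i' ii'|i j j0]; rewrite !ffunE /=.
- apply: (sorted_leq_nth ole_trans ole_refl x0 r_sorted) => //; rewrite inE size_r.
    exact: (ltn_ord j).
  exact: (ltn_ord j').
- by apply: (sorted_ltn_nth olt_trans x0 S_sorted) => //; rewrite inE size_S.
- have : nth x0 (enum S) i \in S by rewrite -mem_enum mem_nth ?size_S.
  move/SP; rewrite /cell_col /= j0 r0 in_setD1 ltn_neqAle eq_sym => /andP[-> /x0_min].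
  exact.
Qed.

Lemma card_tabs : #|tabs| = 'C(#|P|.-1, k).
Proof.
rewrite -(card_in_imset leg_set_inj).
have -> : leg_set @: tabs = [set S : {set 'I_n} | (S \subset P :\ x0) && (#|S| == k)].
  apply/setP => S; rewrite inE; apply/imsetP/andP => [[T /leg_set_draw/andP TP ->] //|].
  by move=> [SP /eqP Sk]; have [T] := leg_set_onto SP Sk; exists T.
by rewrite cards_draws [in RHS](cardsD1 x0) x0P.
Qed.

End HookTableaux.

(** The leg entries form an arbitrary k-subset of the entries present other than
    the least one; N > 0 ensures that some entry is present. *)
Lemma kostka_hook (N k n : nat) (c : 'I_n -> nat) : k < N -> \sum_i c i = N ->
  kostka (hook N k) (fun i => (c i)%:Z%R) = 'C(#|[set i | 0 < c i]|.-1, k).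
Proof.
move=> ltkN sumc.
have [x x_pos] : exists x, 0 < c x.
  apply/existsP; apply: contraTT ltkN; rewrite negb_exists => /forallP c0.
  by rewrite -sumc big1 // => i _; apply/eqP; rewrite -leqn0 leqNgt c0.
have [x0 x0_pos x0_min] := arg_minnP (P := fun x => 0 < c x) (@nat_of_ord n) x_pos.
by apply: (card_tabs ltkN sumc (x0 := x0)) => [|y]; rewrite inE //; apply: x0_min.
Qed.

Lemma eq_kostka (th : seq nat) (n : nat) (c c' : 'I_n -> int) :
  c =1 c' -> kostka th c = kostka th c'.
Proof.
move=> ec; apply: eq_card => T; rewrite !inE; congr (_ && _).
by apply: eq_forallb => i; rewrite ec.
Qed.

Lemma kostka_neg (th : seq nat) (n : nat) (c : 'I_n -> int) i :
  (c i < 0)%R -> kostka th c = 0.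
Proof.
move=> ci; apply/eqP; rewrite cards_eq0; apply/eqP/setP => T; rewrite !inE.
apply/negP => /andP[_ /forallP/(_ i)/eqP ei].
by move: ci; rewrite -ei.
Qed.

(** * Jacobi-Trudi entries and Hessenberg functions *)

Section SkewShape.

Variables (n : nat) (mu nu : seq nat).
Hypotheses (skew : is_skew_shape mu nu) (len : skew_length mu nu = n).
Hypothesis noempty : no_empty_rows mu nu.

Local Notation jt := (jt_entry mu nu).
Local Notation h := (hess n mu nu).

Lemma jt_entry_lt i i' j : i < i' -> (jt i' j < jt i j)%R.
Proof.
case: skew => pmu _ _ ii'; rewrite /jt_entry.
have := part_le pmu (ltnW ii'); lia.
Qed.

Lemma jt_entry_diag_gt0 (i : nat) : i < n -> (0 < jt i i)%R.
Proof. by rewrite -len => /noempty; rewrite /jt_entry; lia. Qed.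

Lemma leq_hess (i j : 'I_n) : (i <= h j) = (0 <= jt i j)%R.
Proof.
rewrite ffunE; case: arg_maxnP => [|m jm m_max].
  exact/ltW/jt_entry_diag_gt0.
apply/idP/idP => [|/m_max //].
by rewrite leq_eqVlt => /predU1P[->//|/(jt_entry_lt j)]; lia.
Qed.

Lemma jt_hess_ge0 (j : 'I_n) : (0 <= jt (h j) j)%R.
Proof. by rewrite -leq_hess. Qed.

(** If jt i j = 0, then i is the last index with a nonnegative entry in column j,
    so that lowering h j by one discards exactly this index. *)
Lemma leq_hessJ (J : {set 'I_n}) (i j : 'I_n) :
  (i <= hessJ mu nu J j) = (0 <= jt i j)%R && ((j \in J) ==> (jt i j != 0%R)).
Proof.
rewrite ffunE -leq_hess; case: (boolP (j \in J)) => [jJ|_] /=; last by rewrite andbT.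
case: eqP => [h0|h0] /=; last first.
  case: leqP => //= ih; apply/esym/eqP => i0.
  have := jt_hess_ge0 j; move: ih; rewrite leq_eqVlt => /predU1P[/val_inj e|/(jt_entry_lt j)].
    by rewrite -e in h0.
  lia.
(* The predecessor of h j is not truncated: the diagonal entry is positive,
   whereas the one in row h j is zero. *)
have jh : j < h j.
  rewrite ltn_neqAle leq_hess ltW ?jt_entry_diag_gt0 // andbT.
  by apply: contraTneq (jt_entry_diag_gt0 (ltn_ord j)) => e; rewrite {1}e h0.
have -> : (i <= (h j).-1) = (i < h j) by lia.
case: (ltngtP i (h j)) => //= [/(jt_entry_lt j)|->]; last by rewrite h0 eqxx.
by rewrite h0 => /gt_eqF ->.
Qed.

Lemma hess_ind_hessJ (J : {set 'I_n}) (w : 'S_n) : J \subset init_seg n ->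
  hess_ind (hessJ mu nu J) w =
  [forall j, 0 <= jt (w j) j]%R
    && (J \subset [set j in init_seg n | 0 < jt (w j) j]%R).
Proof.
move=> /subsetP JI; rewrite /hess_ind; congr nat_of_bool.
apply/forallP/andP => [wJ|[/forallP w0 /subsetP wJ] j]; last first.
  rewrite leq_hessJ w0; apply/implyP => /wJ.
  by rewrite inE => /andP[_ /gt_eqF ->].
split; first by apply/forallP => j; have := wJ j; rewrite leq_hessJ => /andP[].
apply/subsetP => j jJ; rewrite inE JI //=; have := wJ j.
by rewrite leq_hessJ jJ /= lt0r andbC.
Qed.

Lemma immanant_content_perm (w : 'S_n) (j : 'I_n) :
  immanant_content mu nu w (w j) = jt (w j) j.
Proof.
rewrite /immanant_content /perm_act permK /jt_entry /delta.
have := ltn_ord j; have := ltn_ord (w j); lia.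
Qed.

(** Beyond row n, mu and nu agree. *)
Lemma sum_row_lengths : \sum_(i < n) (part mu i - part nu i) = skew_size mu nu.
Proof.
have n_size : n <= size mu.
  by rewrite -len; apply/bigmax_leqP => i _; apply: ltn_ord.
have full i : n <= i -> i < size mu -> part mu i - part nu i = 0.
  move=> ni im; apply/eqP; rewrite subn_eq0 leqNgt; apply/negP => lt_i.
  have := @leq_bigmax_cond _ (fun i : 'I_(size mu) => part nu i < part mu i)
    (fun i => i.+1) (Ordinal im) lt_i.
  by rewrite -/(skew_length mu nu) len /= ltnNge ni.
rewrite /skew_size (big_ord_widen _ (fun i => part mu i - part nu i) n_size).
rewrite big_mkcond; apply: eq_bigr => i _.
by case: ltnP => // ni; rewrite full.
Qed.

(** Permuting the entries of nu + delta does not change their sum. *)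
Lemma sum_immanant_content (w : 'S_n) :
  (\sum_i immanant_content mu nu w i)%R = (skew_size mu nu)%:Z%R.
Proof.
rewrite sumrB /perm_act [X in (_ - X)%R](reindex_perm w) /=.
under [X in (_ - X)%R]eq_bigr do rewrite permK.
rewrite -sumrB -sum_row_lengths (big_morph Posz PoszD (erefl _)).
apply: eq_bigr => i _; case: skew => _ _ /(_ i); lia.
Qed.

(** The content at row w last is always positive, where last is the last index:
    w last <= last, and columns decrease down to the positive diagonal entry. *)
Lemma card_pos_content (w : 'S_n) : 0 < n ->
  #|[set i | 0 < immanant_content mu nu w i]%R|.-1 =
  #|[set j in init_seg n | 0 < jt (w j) j]%R|.
Proof.
move=> n0; have lt_last : n.-1 < n by rewrite prednK.
pose last := Ordinal lt_last.
have -> : [set i | 0 < immanant_content mu nu w i]%R = w @: [set j : 'I_n | 0 < jt (w j) j]%R.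
  apply/setP => i; rewrite -[i](permKV w) mem_imset ?inE; last exact: perm_inj.
  by rewrite immanant_content_perm.
rewrite card_imset; last exact: perm_inj.
have pos_last : (0 < jt (w last) last)%R.
  apply: lt_le_trans (jt_entry_diag_gt0 lt_last) _.
  have : w last <= last by have := ltn_ord (w last); rewrite /=; lia.
  by rewrite leq_eqVlt => /predU1P[->//|/(jt_entry_lt last)/ltW].
rewrite (cardsD1 last) inE pos_last; apply: eq_card => j.
rewrite !inE; congr (_ && _); rewrite -val_eqE /=; have := ltn_ord j; lia.
Qed.

(** The heart of the matter: both sides count k-subsets of a set with as many
    elements as the content has positive entries, minus one; and both vanish when
    the content has a negative entry. *)
Lemma kostka_hook_content (k : nat) (w : 'S_n) : k < skew_size mu nu ->
  kostka (hook (skew_size mu nu) k) (immanant_content mu nu w) =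
  \sum_(J in ksubsets n k) hess_ind (hessJ mu nu J) w.
Proof.
move=> ltk; have n0 : 0 < n.
  by case: n sum_row_lengths => // /esym; rewrite big_ord0; lia.
pose D := [set j in init_seg n | 0 < jt (w j) j]%R.
have -> : \sum_(J in ksubsets n k) hess_ind (hessJ mu nu J) w =
  [forall j, 0 <= jt (w j) j]%R * #|[set J : {set 'I_n} | (J \subset D) && (#|J| == k)]|.
  rewrite -sum1_card big_distrr big_mkcond [in RHS]big_mkcond; apply: eq_bigr => J _ /=.
  rewrite !inE; case: (boolP (J \subset init_seg n)) => JI; last first.
    case: ifP => // /andP[JD _]; case/negP: JI; apply: subset_trans JD _.
    by apply/subsetP => j; rewrite inE => /andP[].
  rewrite hess_ind_hessJ // -/D; case: eqP; rewrite ?andbF // andbT => _.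
  by case: (J \subset D); rewrite ?andbT ?andbF ?muln1.
rewrite cards_draws; case: (boolP [forall j, _]) => [/forallP w0|/forallPn[j]]; last first.
  by rewrite -ltNge -immanant_content_perm mul0n => /kostka_neg ->.
have c0 i : (0 <= immanant_content mu nu w i)%R.
  by rewrite -[i](permKV w) immanant_content_perm.
have cE i : (`|immanant_content mu nu w i|%N)%:Z%R = immanant_content mu nu w i.
  exact: gez0_abs.
rewrite mul1n -card_pos_content // -(eq_kostka _ cE) kostka_hook //.
  by congr ('C(_.-1, _)); apply: eq_card => i; rewrite !inE -[in RHS]cE.
apply/eqP; rewrite -eqz_nat -(sum_immanant_content w) (big_morph Posz PoszD (erefl _)).
by apply/eqP/eq_bigr => i _.
Qed.

(** * Multiplicities *)

Lemma hessJ_eq (J J' : {set 'I_n}) :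
  (hessJ mu nu J' == hessJ mu nu J) =
  (J' :&: [set j | jt (h j) j == 0%R] == J :&: [set j | jt (h j) j == 0%R]).
Proof.
apply/eqP/eqP => eJ; last first.
  apply/ffunP => j; rewrite [LHS]ffunE [RHS]ffunE.
  by have := congr1 (fun S : {set 'I_n} => j \in S) eJ; rewrite !inE => ->.
apply/setP => j; rewrite !inE andbC [RHS]andbC; case: eqP => //= hj.
have := congr1 (fun g : {ffun 'I_n -> 'I_n} => h j <= g j) eJ.
by rewrite !leq_hessJ hj lexx /= !implybF => /negb_inj.
Qed.

Lemma hessJ_neq_hess (J : {set 'I_n}) (j : 'I_n) :
  (h j != hessJ mu nu J j) = (j \in J) && (jt (h j) j == 0%R).
Proof.
have [e|ne] := eqVneq (h j) (hessJ mu nu J j).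
  have := leq_hessJ J (h j) j; rewrite -e leqnn jt_hess_ge0 /=.
  by case: (j \in J) => //= /esym/negbTE ->.
by move: ne; rewrite [hessJ _ _ _ _]ffunE; case: ifP => // _; rewrite eqxx.
Qed.

(** A subset with the same Hessenberg function as J is the union of the elements
    of J that lower h, which are forced, and a free choice of positions in F. *)
Lemma hessJ_mult_binomial (k : nat) (J : {set 'I_n}) : J \in ksubsets n k ->
  hessJ_mult mu nu k J = 'C(free_count n mu nu, k - lowered_count mu nu J).
Proof.
rewrite inE => /andP[JI /eqP Jk].
set F := [set i in init_seg n | 0 < jt (h i) i]%R.
set Z := [set j : 'I_n | jt (h j) j == 0%R].
have -> : lowered_count mu nu J = #|J :&: Z|.
  apply: eq_card => j; rewrite !inE hessJ_neq_hess andb_idl //.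
  by case/andP=> /(subsetP JI); rewrite inE.
have FZ : F :&: (J :&: Z) = set0.
  by apply/setP => j; rewrite !inE; case: (ltgtP 0%R (jt (h j) j)); rewrite ?andbF.
have split_init (J' : {set 'I_n}) : J' \subset init_seg n -> J' = (J' :&: F) :|: (J' :&: Z).
  move=> /subsetP J'I; rewrite -setIUr; apply/esym/setIidPl/subsetP => j /J'I jI.
  by rewrite in_setU [j \in F]in_set [j \in Z]in_set jI /= eq_sym orbC -le_eqVlt jt_hess_ge0.
rewrite -cards_draws -(card_in_imset (f := fun B => B :|: (J :&: Z))).
  apply: eq_card => J'; rewrite in_set hessJ_eq -/Z; apply/andP/imsetP.
    rewrite inE => -[/andP[J'I /eqP J'k] /eqP eZ]; exists (J' :&: F).
      rewrite inE subsetIr /=; apply/eqP; rewrite -J'k [in RHS](split_init J' J'I) eZ.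
      rewrite cardsU -setIA FZ setI0 cards0 subn0 addnK //.
    by rewrite -eZ -split_init.
  move=> [B]; rewrite inE => /andP[BF /eqP Bk] ->.
  have B0 : B :&: (J :&: Z) = set0.
    by apply/eqP; rewrite -subset0 -FZ; apply: setSI.
  rewrite inE; split.
    rewrite subUset (subset_trans BF) ?subsetIl ?(subset_trans (subsetIl _ _)) //=; last first.
      by apply/subsetP => j; rewrite inE => /andP[].
    by rewrite cardsU B0 cards0 subn0 Bk subnK // -Jk subset_leq_card ?subsetIl.
  rewrite setIUl -setIA setIid; suff -> : B :&: Z = set0 by rewrite set0U.
  apply/setP => j; rewrite !inE; apply/negP => /andP[/(subsetP BF)].
  by rewrite inE => /andP[_ /gt_eqF ->].
move=> B B'; rewrite !inE => /andP[BF _] /andP[BF' _] e.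
have cancel (C : {set 'I_n}) : C \subset F -> (C :|: (J :&: Z)) :&: F = C.
  by move=> /setIidPl CF; rewrite setIUl CF setIC FZ setU0.
by rewrite -(cancel B) // e cancel.
Qed.

End SkewShape.

(** * Sums over the sets J *)

Lemma class_sum_sum (n : nat) (I : finType) (A : {pred I}) (f : I -> 'S_n -> nat) w :
  class_sum (fun w' => \sum_(i in A) f i w') w = (\sum_(i in A) class_sum (f i) w)%R.
Proof.
rewrite /class_sum exchange_big big_distrr /=.
exact: (big_morph Posz PoszD (erefl _)).
Qed.

(** Group the k-subsets by the unique representative with the same function. *)
Lemma sum_over_representatives (n k : nat) (mu nu : seq nat) (R : {set {set 'I_n}})
    (F : {ffun 'I_n -> 'I_n} -> int) :
  is_hessJ_representatives mu nu k R ->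
  (\sum_(J in ksubsets n k) F (hessJ mu nu J) =
   \sum_(J in R) (hessJ_mult mu nu k J)%:Z * F (hessJ mu nu J))%R.
Proof.
move=> [_ repR].
have pick J' : J' \in ksubsets n k ->
  F (hessJ mu nu J') = (\sum_(J in R | hessJ mu nu J' == hessJ mu nu J) F (hessJ mu nu J))%R.
  move=> /repR[J [[JR eJ] uJ]]; rewrite (big_pred1 J) ?eJ // => J2 /=.
  apply/andP/eqP => [[J2R /eqP e]|->]; last by rewrite eJ.
  by apply/esym/uJ.
rewrite (eq_bigr _ pick) (exchange_big_dep (mem R)) /=; last by move=> ? ? _ /andP[].
apply: eq_bigr => J JR; rewrite JR /hessJ_mult.
rewrite sumr_const -mulr_natl natz; congr (_%:Z * _)%R.
by apply: eq_card => J'; rewrite inE unfold_in.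
Qed.

Unset Implicit Arguments.

Theorem corollary4p3 (N k n : nat) (mu nu : seq nat)
    (k_lt_N : (k < N)%N)
    (skew : is_skew_shape mu nu)
    (len : skew_length mu nu = n)
    (noempty : no_empty_rows mu nu)
    (sz : skew_size mu nu = N) :
  (forall w : 'S_n,
     immanant_char (hook N k) mu nu w
     = (\sum_(J in ksubsets n k) hess_char (hessJ mu nu J) w)%R)
  /\
  (forall R : {set {set 'I_n}}, is_hessJ_representatives mu nu k R ->
     (forall w : 'S_n,
        immanant_char (hook N k) mu nu w
        = (\sum_(J in R)
             (hessJ_mult mu nu k J)%:Z * hess_char (hessJ mu nu J) w)%R)
     /\
     (forall J : {set 'I_n}, J \in R ->
        hessJ_mult mu nu k J
        = 'C(free_count n mu nu, k - lowered_count mu nu J))).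
Proof.
have hook_sum (w : 'S_n) : immanant_char (hook N k) mu nu w
    = (\sum_(J in ksubsets n k) hess_char (hessJ mu nu J) w)%R.
  rewrite -class_sum_sum /immanant_char /class_sum; congr ((_ * _)%N%:Z%R).
  by apply: eq_bigr => w' _; rewrite -sz kostka_hook_content // sz.
split=> // R repR; split=> [w|J JR].
  rewrite hook_sum.
  exact: (sum_over_representatives (fun g => hess_char g w) repR).
by apply: hessJ_mult_binomial => //; case: repR => /subsetP/(_ J JR).
Qed.
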